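(* Let $E_1,E_2$ be propositional variables and $\delta$ a new atomic formula symbol. Write $\veebar$ for exclusive disjunction. Then $\mathsf{QLP}(\delta\leftrightarrow[E_1\wedge\neg(\exists x)x:(\delta\rightarrow E_1)]\veebar[E_2\wedge\neg(\exists x)x:(\delta\wedge\neg E_1\rightarrow E_2)])_{\emptyset}\vdash\neg\delta$, where this logic is $\mathsf{QLP}$ without Axiom Necessitation, over the language extended by $\delta$, with that single additional axiom.
   Context: Fix countably many justification variables, propositional variables, and primitive function symbols of each arity $n\ge0$; a primitive term is $f(x_1,\dots,x_n)$. Terms of $\mathsf{QLP}$: $t::= x\mid f(x_1,\dots,x_n)\mid t\cdot t\mid t+t\mid !t\mid(t\forall x)$ ($x$ bound in $(t\forall x)$). Formulas: $A::= p\mid\bot\mid\neg A\mid A\wedge A\mid A\vee A\mid A\rightarrow A\mid t:A\mid(\forall x)A\mid(\exists x)A$. Axioms: all propositional tautologies; Q1: $(\forall x)A(x)\rightarrow A(t)$, $t$ free for $x$; Q2: $(\forall x)(A\rightarrow B(x))\rightarrow(A\rightarrow(\forall x)B(x))$, $x$ not free in $A$; Q3: $A(t)\rightarrow(\exists x)A(x)$, $t$ free for $x$; Q4: $(\forall x)(A(x)\rightarrow B)\rightarrow((\exists x)A(x)\rightarrow B)$, $x$ not free in $B$; jK: $s:(A\rightarrow B)\rightarrow(t:A\rightarrow(s\cdot t):B)$; jT: $t:A\rightarrow A$; j4: $t:A\rightarrow !t:t:A$; Sum: $s:A\rightarrow(s+t):A$, $s:A\rightarrow(t+s):A$; UF: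 $(\exists y)y:(\forall x)t:A\rightarrow(t\forall x):(\forall x)A$, $y$ not free in $t$ or $A$. Rules: Modus Ponens; Gen: from $A$ infer $(\forall x)A$; qNec: from $A$ infer $(\exists x)x:A$, $x$ not free in $A$; Axiom Necessitation: from an axiom instance $A$ infer $f(x_1,\dots,x_n):A$. The subscript $\emptyset$ means Axiom Necessitation is dropped. All schemes and rules apply to formulas of the extended language. *)

(* Defs.v *)
From HB Require Import structures.
From mathcomp Require Import all_boot.

Set Implicit Arguments.
Unset Strict Implicit.
Unset Printing Implicit Defensive.

Definition jvar := nat.
Definition propvar := nat.

(* [TFun n k xs] applies the [k]-th primitive function symbol of arity [n].
   Its arguments are justification variables, not arbitrary terms. *)
Inductive term : Type :=
| TVar of jvar
| TFun (n k : nat) of n.-tuple jvar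
| TApp of term & term
| TSum of term & term
| TBang of term
| TUni of term & jvar.   (* [TUni t x] is (t forall x), which binds [x] *)

Inductive atom : Type := PVar of propvar | Delta.

Inductive form : Type :=
| FAtom of atom
| FBot
| FNot of form
| FAnd of form & form
| FOr of form & form
| FImp of form & form
| FJust of term & form
| FAll of jvar & form
| FEx of jvar & form.

Declare Scope qlp_scope.
Delimit Scope qlp_scope with qlp.
Bind Scope qlp_scope with form.

Notation "⊥" := FBot : qlp_scope.
Notation "¬ A" := (FNot A) (at level 35, right associativity) : qlp_scope.
Notation "A ∧ B" := (FAnd A B) (at level 40, left associativity) : qlp_scope.
Notation "A ∨ B" := (FOr A B) (at level 50, left associativity) : qlp_scope.
Notation "A ⟶ B" := (FImp A B) (at level 55, right associativity) : qlp_scope.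
Notation "t ∴ A" := (FJust t A) (at level 35, right associativity) : qlp_scope.
Notation "'Π' x , A" := (FAll x A) (at level 35, x at level 0, A at level 35,
  right associativity) : qlp_scope.
Notation "'Σ' x , A" := (FEx x A) (at level 35, x at level 0, A at level 35,
  right associativity) : qlp_scope.
Local Open Scope qlp_scope.

Definition FIff (A B : form) : form := (A ⟶ B) ∧ (B ⟶ A).
Definition FXor (A B : form) : form := (A ∨ B) ∧ ¬ (A ∧ B).
Notation "A ⟷ B" := (FIff A B) (at level 57, no associativity) : qlp_scope.
Notation "A ⊻ B" := (FXor A B) (at level 53, no associativity) : qlp_scope.

Fixpoint fvT (t : term) : seq jvar :=
  match t with
  | TVar x => [:: x]
  | TFun _ _ xs => xs
  | TApp s t | TSum s t => fvT s ++ fvT t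
  | TBang s => fvT s
  | TUni s x => [seq y <- fvT s | y != x]
  end.

Fixpoint fv (A : form) : seq jvar :=
  match A with
  | FAtom _ | FBot => [::]
  | FNot B => fv B
  | FAnd B C | FOr B C | FImp B C => fv B ++ fv C
  | FJust t B => fvT t ++ fv B
  | FAll x B | FEx x B => [seq y <- fv B | y != x]
  end.

Definition omap2 (T U V : Type) (f : T -> U -> V) (a : option T) (b : option U)
    : option V :=
  if a is Some x then omap (f x) b else None.

(* Replacement of the free occurrences of [x] by [t].  It is partial: since the
   arguments of a primitive term are variables, f(.., x, ..) has an instance
   only when [t] is itself a variable. *)
Fixpoint substT (x : jvar) (t s : term) : option term :=
  match s with
  | TVar y => Some (if y == x then t else s)
  | TFun n k ys =>
      if x \notin ys then Some s
      else if t is TVar z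
           then Some (TFun k (map_tuple (fun y => if y == x then z else y) ys))
           else None
  | TApp s1 s2 => omap2 TApp (substT x t s1) (substT x t s2)
  | TSum s1 s2 => omap2 TSum (substT x t s1) (substT x t s2)
  | TBang s1 => omap TBang (substT x t s1)
  | TUni s1 y => if y == x then Some s else omap (TUni^~ y) (substT x t s1)
  end.

Fixpoint subst (x : jvar) (t : term) (A : form) : option form :=
  match A with
  | FAtom _ | FBot => Some A
  | FNot B => omap FNot (subst x t B)
  | FAnd B C => omap2 FAnd (subst x t B) (subst x t C)
  | FOr B C => omap2 FOr (subst x t B) (subst x t C)
  | FImp B C => omap2 FImp (subst x t B) (subst x t C)
  | FJust s B => omap2 FJust (substT x t s) (subst x t B)
  | FAll y B => if y == x then Some A else omap (FAll y) (subst x t B)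
  | FEx y B => if y == x then Some A else omap (FEx y) (subst x t B)
  end.

(* [t] is free for [x]: no variable of [t] is captured by a quantifier or by
   the term binder (s forall y). *)
Fixpoint free_forT (t : term) (x : jvar) (s : term) : bool :=
  match s with
  | TVar _ | TFun _ _ _ => true
  | TApp s1 s2 | TSum s1 s2 => free_forT t x s1 && free_forT t x s2
  | TBang s1 => free_forT t x s1
  | TUni s1 y => (x \notin fvT s) || (y \notin fvT t) && free_forT t x s1
  end.

Fixpoint free_for (t : term) (x : jvar) (A : form) : bool :=
  match A with
  | FAtom _ | FBot => true
  | FNot B => free_for t x B
  | FAnd B C | FOr B C | FImp B C => free_for t x B && free_for t x C
  | FJust s B => free_forT t x s && free_for t x B
  | FAll y B | FEx y B =>
      (x \notin fv A) || (y \notin fvT t) && free_for t x B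
  end.

(* Truth-functional evaluation, in which the formulas that are not built by a
   propositional connective get arbitrary values. *)
Fixpoint eval (v : form -> bool) (A : form) : bool :=
  match A with
  | FBot => false
  | FNot B => ~~ eval v B
  | FAnd B C => eval v B && eval v C
  | FOr B C => eval v B || eval v C
  | FImp B C => eval v B ==> eval v C
  | FAtom _ | FJust _ _ | FAll _ _ | FEx _ _ => v A
  end.

Definition tautology (A : form) : Prop := forall v, eval v A.

Inductive qlp_axiom : form -> Prop :=
| ax_taut A : tautology A -> qlp_axiom A
| ax_Q1 x A t B : free_for t x A -> subst x t A = Some B ->
    qlp_axiom (Π x, A ⟶ B)
| ax_Q2 (x : jvar) A B : x \notin fv A ->
    qlp_axiom (Π x, (A ⟶ B) ⟶ (A ⟶ Π x, B))
| ax_Q3 x A t B : free_for t x A -> subst x t A = Some B ->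
    qlp_axiom (B ⟶ Σ x, A)
| ax_Q4 (x : jvar) A B : x \notin fv B ->
    qlp_axiom (Π x, (A ⟶ B) ⟶ (Σ x, A ⟶ B))
| ax_jK s t A B :
    qlp_axiom (s ∴ (A ⟶ B) ⟶ (t ∴ A ⟶ TApp s t ∴ B))
| ax_jT t A : qlp_axiom (t ∴ A ⟶ A)
| ax_j4 t A : qlp_axiom (t ∴ A ⟶ TBang t ∴ t ∴ A)
| ax_Suml s t A : qlp_axiom (s ∴ A ⟶ TSum s t ∴ A)
| ax_Sumr s t A : qlp_axiom (s ∴ A ⟶ TSum t s ∴ A)
| ax_UF (x y : jvar) t A : y \notin fvT t -> y \notin fv A ->
    qlp_axiom (Σ y, TVar y ∴ Π x, t ∴ A ⟶ TUni t x ∴ Π x, A).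

(* Theorems of QLP(D) without Axiom Necessitation, where [D] is the single
   additional axiom. *)
Inductive QLP_empty (D : form) : form -> Prop :=
| thm_ax A : qlp_axiom A -> QLP_empty D A
| thm_ext : QLP_empty D D
| thm_MP A B : QLP_empty D (A ⟶ B) -> QLP_empty D A -> QLP_empty D B
| thm_Gen x A : QLP_empty D A -> QLP_empty D (Π x, A)
| thm_qNec (x : jvar) A : x \notin fv A -> QLP_empty D A ->
    QLP_empty D (Σ x, TVar x ∴ A).

(* Main.v *)
(* A day-two surprise would give E2, so delta and not E1 imply E2; qNec then
   makes this implication justified, which refutes the second disjunct.  What
   remains yields delta -> E1, and one more qNec refutes the first disjunct. *)
From mathcomp Require Import all_boot.
Require Import Defs.

Set Implicit Arguments.
Unset Strict Implicit.
Unset Printing Implicit Defensive.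

Local Open Scope qlp_scope.

Lemma thm_taut_MP D A B : tautology (A ⟶ B) -> QLP_empty D A -> QLP_empty D B.
Proof. by move=> AB; apply/thm_MP/thm_ax/ax_taut. Qed.

Lemma thm_taut_MP2 D A B C :
  tautology (A ⟶ B ⟶ C) -> QLP_empty D A -> QLP_empty D B -> QLP_empty D C.
Proof. by move=> ABC thA; apply/thm_MP/(thm_taut_MP ABC thA). Qed.

Theorem theorem29 (p1 p2 : propvar) (x : jvar) :
  let E1 := FAtom (PVar p1) in
  let E2 := FAtom (PVar p2) in
  let delta := FAtom Delta in
  QLP_empty
    (delta ⟷ (E1 ∧ ¬ Σ x, TVar x ∴ (delta ⟶ E1))
               ⊻ (E2 ∧ ¬ Σ x, TVar x ∴ (delta ∧ ¬ E1 ⟶ E2)))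
    (¬ delta).
Proof.
move=> E1 E2 delta; set D := FIff _ _.
have J2 : QLP_empty D (Σ x, TVar x ∴ (delta ∧ ¬ E1 ⟶ E2)).
  (* No justification variable is free here, so [thm_qNec] applies with any [x]. *)
  apply: thm_qNec => //; apply: thm_taut_MP (thm_ext D) => v /=.
  (* [eval] treats both existential formulas as atoms, leaving five truth values. *)
  by case: (v delta); case: (v E1); case: (v E2); do 2!case: (v (FEx _ _)).
have J1 : QLP_empty D (Σ x, TVar x ∴ (delta ⟶ E1)).
  (* By [J2], [delta] can only come from the first disjunct, which contains [E1]. *)
  apply: thm_qNec => //; apply: thm_taut_MP2 (thm_ext D) J2 => v /=.
  by case: (v delta); case: (v E1); case: (v E2); do 2!case: (v (FEx _ _)).
(* With [J1] and [J2] both disjuncts fail, so [D] refutes [delta]. *)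
apply: thm_MP J1; apply: thm_taut_MP2 (thm_ext D) J2 => v /=.
by case: (v delta); case: (v E1); case: (v E2); do 2!case: (v (FEx _ _)).
Qed.
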